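(* Let $\mathbf{X}$ be a metric space, let $\mathbf{K}$ be a nonempty compact subset of $C(\mathbf{T},\mathbf{X})$, and let $\mathbf{V}$ be a nonempty set of nonempty compact subsets of $\mathbf{K}$, i.e. $\varnothing\neq\mathbf{V}\subset (comp)(\mathbf{K})$. Let $\widetilde{\mathbf{V}}$ be the closure of $\mathbf{V}$ in $(comp)(\mathbf{K})$ with respect to the Vietoris topology. Then for every continuous function $c:C(\mathbf{T},\mathbf{X})\to\mathbf{T}$, $$\max_{\Phi\in\widetilde{\mathbf{V}}}\ \min_{x\in\Phi} c(x)=\sup_{\Phi\in\mathbf{V}}\ \inf_{x\in\Phi} c(x),$$ where, in particular, the maximum and the minima on the left-hand side are attained.
   Context: $\mathbf{T}=\{t\in\mathbb{R}: t\geqslant 0\}$. $C(\mathbf{T},\mathbf{X})$ is the space of continuous maps $\mathbf{T}\to\mathbf{X}$ with the compact-open topology (metrizable; equivalently, the topology of uniform convergence on compact subsets of $\mathbf{T}$). For a topological space $Y$, $(comp)(Y)$ denotes the set of all nonempty compact subsets of $Y$, equipped with the Vietoris topology; for metrizable $Y$ this is the topology of the Hausdorff metric. *)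

(* Defs.v *)
From HB Require Import structures.
From mathcomp Require Import all_boot all_order all_algebra.
From mathcomp Require Import all_classical all_reals all_analysis.

Set Implicit Arguments.
Unset Strict Implicit.
Unset Printing Implicit Defensive.

Import Order.TTheory GRing.Theory Num.Theory.
Import numFieldNormedType.Exports.

Local Open Scope classical_set_scope.
Local Open Scope ring_scope.

(* [set_type (halfline R)] carries the subspace topology inherited from R. *)
Definition halfline (R : realType) : set R := [set t | 0 <= t].

Arguments halfline R : clear implicits.

Section continuous_paths.
Context {R : realType} (X : metricType R).

(* C(T, X); a named copy of the type of continuous maps, so that its topology is
   the compact-open one whatever [ArrowAs...] module is imported. *)
Definition cpath : Type := continuousType (set_type (halfline R)) X.

HB.instance Definition _ := Choice.on cpath.

HB.instance Definition _ := Topological.copy cpath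
  (initial_topology (id : cpath -> {compact-open, set_type (halfline R) -> X})).

End continuous_paths.

Section hyperspace.
Context (Y : topologicalType).

(* A named copy of the subtype, so that its topology is the one declared below
   and never a subspace topology inherited from [set Y]. *)
Definition compacts : Type :=
  set_type [set F : set Y | F !=set0 /\ compact F].

HB.instance Definition _ := Choice.on compacts.

Definition compact_val (F : compacts) : set Y := set_val F.

Definition vietoris_subbase : set (set compacts) :=
  [set S | exists2 U : set Y, open U &
     S = [set F : compacts | compact_val F `<=` U] \/
     S = [set F : compacts | compact_val F `&` U !=set0]].

HB.instance Definition _ :=
  @isSubBaseTopological.Build compacts (set compacts) vietoris_subbase id.

End hyperspace.

Definition is_min (R : realType) (A : set R) (m : R) := A m /\ lbound A m.

Definition is_max (R : realType) (A : set R) (m : R) := A m /\ ubound A m.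

(* Main.v *)
Require Import Defs.
From HB Require Import structures.
From mathcomp Require Import all_boot all_order all_algebra.
From mathcomp Require Import all_classical all_reals all_analysis.

Import Order.TTheory GRing.Theory Num.Theory.
Import numFieldNormedType.Exports.

Local Open Scope classical_set_scope.
Local Open Scope ring_scope.

(** The space of paths only enters through the compact space [Y := K] and the
    continuous function [f := c] restricted to [Y].  Two facts about the
    Vietoris topology give the theorem.

    The function sending a nonempty compact set [F] to the minimum of [f] over
    [F] is continuous ([continuous_compacts_inf]): the minimum exceeds [a]
    exactly when [F] is contained in the open set where [f > a], and is less
    than [b] exactly when [F] meets the open set where [f < b]; these are the
    two kinds of subbasic open sets.

    The hyperspace of a compact space is compact ([compact_compacts]), so the
    closure of [V] is compact and the minimum function attains its maximum
    there.  A continuous function cannot exceed on the closure of [V] its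
    supremum over [V], whence the equality ([sup_eq_max_closure]). *)

Set Implicit Arguments.
Unset Strict Implicit.
Unset Printing Implicit Defensive.

Lemma vietoris_subbase_open (Y : topologicalType) (S : set (compacts Y)) :
  vietoris_subbase S -> open S.
Proof.
move=> SS; exists [set S]; last by rewrite bigcup_set1.
by move=> _ ->; exact: (@finI_from1 _ _ _ id).
Qed.

Lemma near_compacts_sub (Y : topologicalType) (F : compacts Y) (U : set Y) :
  open U -> compact_val F `<=` U -> \forall G \near F, compact_val G `<=` U.
Proof.
move=> oU FU; apply: open_nbhs_nbhs; split => //.
by apply: vietoris_subbase_open; exists U => //; left.
Qed.

Lemma near_compacts_meet (Y : topologicalType) (F : compacts Y) (U : set Y) :
  open U -> compact_val F `&` U !=set0 ->
  \forall G \near F, compact_val G `&` U !=set0.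
Proof.
move=> oU FU; apply: open_nbhs_nbhs; split => //.
by apply: vietoris_subbase_open; exists U => //; right.
Qed.

(** The neighborhoods of [F] are generated by finite intersections of subbasic sets,
    so convergence of a filter need only be tested on the subbase. *)
Lemma cvg_compacts (Y : topologicalType) (W : set_system (compacts Y))
    (F : compacts Y) : Filter W ->
  (forall U, open U -> compact_val F `<=` U ->
     \forall G \near W, compact_val G `<=` U) ->
  (forall U, open U -> compact_val F `&` U !=set0 ->
     \forall G \near W, compact_val G `&` U !=set0) ->
  W --> F.
Proof.
move=> FW Wsub Wmeet A /=; rewrite nbhsE nbhs_filterE.
move=> [_ [[B sB <-] [C BC CF]] sUBA].
apply: filterS sUBA _; apply: (@filterS _ _ _ C); first by move=> ? ?; exists C.
have /sB [D sD IDeC] := BC; rewrite -IDeC; apply: filter_bigI => E DE.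
have EF : E F by move: CF; rewrite -IDeC; exact.
have /sD := DE; rewrite inE => -[U oU [] EU]; rewrite EU in EF *.
  exact: Wsub.
exact: Wmeet.
Qed.

(** An ultrafilter [W] of compact sets converges to the set [L] of the points
    all of whose open neighborhoods are met by [W]-almost every set.  A point
    outside [L] has a neighborhood that [W]-almost every set avoids, because [W]
    is an ultrafilter; as the complement of an open [U] containing [L] is
    compact, finitely many such neighborhoods cover it, and [W]-almost every set
    lies in [U].  Taking [U] empty shows that [L] is nonempty. *)
Lemma compact_compacts (Y : topologicalType) :
  compact [set: Y] -> compact [set: compacts Y].
Proof.
move=> cY; rewrite compact_ultra => W UW _.
pose L := [set x | forall U, open U -> U x ->
                     \forall G \near W, compact_val G `&` U !=set0].
have nL x : ~ L x -> exists2 U, nbhs x U &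
    \forall G \near W, forall y, U y -> ~ compact_val G y.
  move=> /existsNP[U /not_implyP[oU /not_implyP[Ux nWU]]].
  exists U; first exact: open_nbhs_nbhs.
  have [//|] := in_ultra_setVsetC [set G | compact_val G `&` U !=set0] UW.
  by apply: filterS => G /= GU y Uy Gy; apply: GU; exists y.
have cL : closed L.
  rewrite -openC openE => x /nL[U]; rewrite nbhsE => -[ O [oO Ox] OU] WU.
  apply: filterS (open_nbhs_nbhs (conj oO Ox)) => z Oz Lz.
  have [G [GU [y [Gy Oy]]]] := filter_ex (filterI WU (Lz O oO Oz)).
  exact: GU (OU _ Oy) Gy.
have catchL (U : set Y) : open U -> L `<=` U ->
    \forall G \near W, compact_val G `<=` U.
  move=> oU LU.
  have cUC : compact (~` U).
    by apply: (subclosed_compact _ cY) => //; exact: open_closedC.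
  (* The extraction of a finite cover is the near-covering form of compactness. *)
  have : \forall G \near W, ~` U `<=` (fun x => ~ compact_val G x).
    move/compact_near_coveringP : cUC; apply => x UCx.
    have /nL[ O Ox WO] : ~ L x by move/LU.
    exists (O, [set G | forall y, O y -> ~ compact_val G y]) => //=.
    by move=> [y G] /= [Oy]; exact.
  apply: filterS => G GU y Gy; apply: contrapT => Uy; exact: GU Uy Gy.
(* Otherwise some member of [compacts Y] would be contained in [set0]. *)
have L0 : L !=set0.
  apply/set0P/negP => /eqP L0.
  have [G G0] : exists G : compacts Y, compact_val G `<=` set0.
    by apply: (filter_ex (catchL set0 _ _)); [exact: open0|rewrite L0].
  by have [[y Gy] _] := set_mem (valP G); exact: G0 Gy.
have kL : compact L by apply: (subclosed_compact cL cY).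
pose F : compacts Y := exist _ L (mem_set (conj L0 kL)).
have FL : compact_val F = L by rewrite /compact_val set_valE.
exists F; split => //; apply: cvg_compacts => U oU; rewrite FL.
  exact: catchL.
by move=> [x [Lx Ux]]; exact: Lx.
Qed.

Definition compacts_inf (R : realType) (Y : topologicalType) (f : Y -> R)
  (F : compacts Y) : R := inf [set f x | x in compact_val F].

Lemma compacts_inf_is_min (R : realType) (Y : topologicalType) (f : Y -> R)
    (F : compacts Y) : continuous f ->
  is_min [set f x | x in compact_val F] (compacts_inf f F).
Proof.
move=> cf; have [F0 cF] := set_mem (valP F).
have [x /set_mem Fx minx] :=
  compact_EVT_min F0 cF (continuous_subspaceT cf).
have lbx : lbound [set f y | y in compact_val F] (f x).
  by move=> _ [y Fy <-]; apply: minx; exact: mem_set.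
suff -> : compacts_inf f F = f x by split => //; exists x.
apply/eqP; rewrite eq_le ge_inf/=; last 2 first.
- by exists (f x).
- by exists x.
by apply: lb_le_inf => //; exists (f x), x.
Qed.

(** The lower bound [min f F - e < min f G] is an inclusion of [G] in an open
    set, the upper bound [min f G < min f F + e] says that [G] meets one. *)
Lemma continuous_compacts_inf (R : realType) (Y : topologicalType)
    (f : Y -> R) : continuous f -> continuous (compacts_inf f).
Proof.
move=> cf F.
apply/(@cvgrPdist_lt _ _ _ (nbhs F) (nbhs_filter F)) => e e0.
have [[x Fx fx] minF] := compacts_inf_is_min F cf.
have oi (A : set R) : open A -> open (f @^-1` A).
  by move=> oA; apply: open_comp => // y _; exact: cf.
near=> G; have [[y Gy fy] minG] := compacts_inf_is_min G cf.
rewrite ltr_distlC; apply/andP; split.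
- rewrite -fy.
  have : compact_val G `<=` f @^-1` [set r | compacts_inf f F - e < r].
    near: G; apply: near_compacts_sub; first by apply: oi; exact: open_gt.
    move=> z Fz /=; rewrite ltrBlDr ltr_pwDr//.
    by apply: minF; exists z.
  exact.
- have : compact_val G `&` f @^-1` [set r | r < compacts_inf f F + e] !=set0.
    near: G; apply: near_compacts_meet; first by apply: oi; exact: open_lt.
    by exists x; split => //=; rewrite fx ltrDl.
  by move=> [z [Gz]]; apply: le_lt_trans; apply: minG; exists z.
Unshelve. all: by end_near. Qed.

Lemma compact_set_type (T : topologicalType) (K : set T) :
  compact K -> compact [set: set_type K].
Proof.
move=> cK F PF _; have FK : F (set_val @^-1` K).
  by apply: filterS filterT => x _ /=; exact: set_mem (valP x).
have [p [Kp clp]] := cK _ (fmap_proper_filter set_val PF) FK.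
exists (exist _ p (mem_set Kp)); split => // A B FA.
rewrite nbhsE => -[_ [[C oC <-] Cp] CB].
have [_ [[x Ax <-] Cx]] : (set_val @` A) `&` C !=set0.
  apply: clp; first by rewrite /= nbhs_simpl; apply: filterS FA => x; exists x.
  exact: open_nbhs_nbhs.
by exists x; split => //; exact: CB.
Qed.

(** Every strict lower bound [s] of [m z], with [z] in the closure of [V], is
    also a strict lower bound of [m] at some point of [V], by continuity of [m];
    so the supremum over [V] is not below the maximum over the closure. *)
Lemma sup_eq_max_closure (R : realType) (Z : topologicalType) (m : Z -> R)
    (V : set Z) (M : R) : continuous m ->
  is_max [set m z | z in closure V] M ->
  M%:E = ereal_sup [set (m z)%:E | z in V].
Proof.
move=> cm [[z Vz mz] maxM]; apply/eqP; rewrite eq_le; apply/andP; split.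
  rewrite leNgt; apply/negP => supM.
  have Vs (y : Z) : V y -> ((m y)%:E <= ereal_sup [set (m z)%:E | z in V])%E.
    by move=> Vy; apply: ereal_sup_ubound; exists y.
  case: (ereal_sup _) supM Vs => [s| |]//.
  - rewrite lte_fin -mz => sM Vs.
    have [y [Vy]] := Vz _ (cm z _ (lt_nbhsr sM)).
    by rewrite /= ltNge => /negP; apply; rewrite -lee_fin; exact: Vs.
  (* The supremum is not -oo, since [V], whose closure is nonempty, is nonempty. *)
  - by move=> _ Vs; have [y [/Vs]] := Vz _ filterT; rewrite leeNy_eq.
apply: ge_ereal_sup => _ [y Vy <-]; rewrite lee_fin; apply: maxM.
by exists y => //; exact: subset_closure.
Qed.

Theorem mainTheorem1 (R : realType) (X : metricType R)
    (K : set (cpath X)) (K_neq0 : K !=set0) (K_compact : compact K)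
    (V : set (compacts (set_type K))) (V_neq0 : V !=set0)
    (c : cpath X -> set_type (halfline R)) (c_cont : continuous c) :
  exists (minc : compacts (set_type K) -> R) (M : R),
    [/\ forall Phi, closure V Phi ->
          is_min [set set_val (c (set_val x)) | x in compact_val Phi]
                 (minc Phi),
        is_max [set minc Phi | Phi in closure V] M &
        M%:E = ereal_sup [set
          ereal_inf [set (set_val (c (set_val x)))%:E | x in compact_val Phi]
          | Phi in V] ].
Proof.
pose f (x : set_type K) : R := set_val (c (set_val x)).
have cf : continuous f.
  move=> x; apply: (@continuous_comp _ _ _ (c \o set_val) set_val).
    apply: continuous_comp; first exact: initial_continuous.
    exact: c_cont.
  exact: initial_continuous.
have cm := continuous_compacts_inf cf.
have cV : compact (closure V).
  by apply: (subclosed_compact (@closed_closure _ V)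
           (compact_compacts (compact_set_type K_compact))) => //.
have V0 : closure V !=set0.
  by have [F VF] := V_neq0; exists F; exact: subset_closure.
have [F /set_mem VF maxF] := compact_EVT_max V0 cV (continuous_subspaceT cm).
have maxM : is_max [set compacts_inf f Phi | Phi in closure V]
    (compacts_inf f F).
  split; first by exists F.
  by move=> _ [G VG <-]; apply: maxF; exact: mem_set.
exists (compacts_inf f), (compacts_inf f F); split => //.
  by move=> Phi _; exact: compacts_inf_is_min.
rewrite (sup_eq_max_closure cm maxM); congr ereal_sup.
apply: eq_imagel => Phi _.
have [[x Phix fx] minPhi] := compacts_inf_is_min Phi cf.
apply/eqP; rewrite eq_le; apply/andP; split.
  apply: le_ereal_inf_tmp => _ [y Phiy <-]; rewrite lee_fin.
  by apply: minPhi; exists y.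
by apply: ereal_inf_lbound; exists x => //; rewrite -fx.
Qed.
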